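(* Let $\mathrm{Homeo}^+([0,1])$ be the group of orientation-preserving homeomorphisms of $[0,1]$, and let $w\in \mathrm{Homeo}^+([0,1])\ast\mathbf F_2$ be a word with constants whose content satisfies $\epsilon(w)\notin[[\mathbf F_2,\mathbf F_2],[\mathbf F_2,\mathbf F_2]]$. Then $w$ is not a mixed identity for $\mathrm{Homeo}^+([0,1])$.
   Context: $[0,1]\subseteq\mathbb R$ carries the metric topology. For a group $G$ and the free group $\mathbf F_r=\langle x_1,\dots,x_r\rangle$, a word with constants in $G$ is an element $w\in G\ast\mathbf F_r$. For $g_1,\dots,g_r\in G$, $w(g_1,\dots,g_r)\in G$ denotes the image of $w$ under the homomorphism $G\ast\mathbf F_r\to G$ that is the identity on $G$ and sends $x_i\mapsto g_i$. The word $w$ is a mixed identity for $G$ if $w\neq1$ in $G\ast\mathbf F_r$ and $w(g_1,\dots,g_r)=1_G$ for all $g_1,\dots,g_r\in G$. The content of $w$ is $\epsilon(w)$, where $\epsilon\colon G\ast\mathbf F_r\to\mathbf F_r$ is the homomorphism that sends every element of $G$ to $1$ and is the identity on $\mathbf F_r$. $[\mathbf F_2,\mathbf F_2]$ denotes the commutator subgroup. *)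

(* Defs.v *)
From HB Require Import structures.
From mathcomp Require Import all_boot all_order all_algebra.
From mathcomp Require Import all_classical all_reals all_analysis.

Set Implicit Arguments.
Unset Strict Implicit.
Unset Printing Implicit Defensive.

Import Order.TTheory GRing.Theory Num.Theory numFieldNormedType.Exports.

Local Open Scope classical_set_scope.
Local Open Scope quotient_scope.
Local Open Scope group_scope.

(* The group < X | rels > : words in the letters (x, false), standing for x, *)
(* and (x, true), standing for x^-1, modulo free cancellation and insertion  *)
(* or deletion of the relators.                                              *)

Section Presentation.
Variables (X : choiceType) (rels : set (seq (X * bool))).
Implicit Types u v w : seq (X * bool).

Inductive word_eq : seq (X * bool) -> seq (X * bool) -> Prop :=
| word_eq_refl u : word_eq u u
| word_eq_sym u v : word_eq u v -> word_eq v u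
| word_eq_trans u v w : word_eq u v -> word_eq v w -> word_eq u w
| word_eq_cancel u v x b : word_eq (u ++ [:: (x, b); (x, ~~ b)] ++ v) (u ++ v)
| word_eq_rel u v r : rels r -> word_eq (u ++ r ++ v) (u ++ v).

Lemma word_eq_cat2l s u v : word_eq u v -> word_eq (s ++ u) (s ++ v).
Proof.
elim=> {u v} [u|u v _|u v w _ + _|u v x b|u v r rr].
- exact: word_eq_refl.
- exact: word_eq_sym.
- exact: word_eq_trans.
- by rewrite !(catA s); apply: word_eq_cancel.
- by rewrite !(catA s); apply: word_eq_rel.
Qed.

Lemma word_eq_cat2r s u v : word_eq u v -> word_eq (u ++ s) (v ++ s).
Proof.
elim=> {u v} [u|u v _|u v w _ + _|u v x b|u v r rr].
- exact: word_eq_refl.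
- exact: word_eq_sym.
- exact: word_eq_trans.
- by rewrite -!catA; apply: word_eq_cancel.
- by rewrite -!catA; apply: word_eq_rel.
Qed.

Definition word_eqb : rel (seq (X * bool)) := fun u v => `[< word_eq u v >].

Lemma word_eqb_equiv : equiv_class_of word_eqb.
Proof.
split=> [u|u v|v u w].
- exact/asboolP/word_eq_refl.
- by apply/asboolP/asboolP; apply: word_eq_sym.
- by move=> /asboolP uv /asboolP vw; apply/asboolP; apply: word_eq_trans vw.
Qed.

Canonical word_equiv := EquivRelPack word_eqb_equiv.

Definition presented := {eq_quot word_equiv}.
HB.instance Definition _ := Choice.on presented.
HB.instance Definition _ := EqQuotient.on presented.

Lemma pres_eqP u v : \pi_presented u = \pi_presented v <-> word_eq u v.
Proof.
split=> [/eqmodP/asboolP //|uv]; exact/eqmodP/asboolP.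
Qed.

Lemma pres_repr u : word_eq (repr (\pi_presented u)) u.
Proof. by apply/pres_eqP; rewrite reprK. Qed.

Definition winv u := rev [seq (l.1, ~~ l.2) | l <- u].

Lemma winvK : involutive winv.
Proof.
move=> u; rewrite /winv map_rev revK -map_comp -[RHS]map_id.
by apply: eq_map => -[x b] /=; rewrite negbK.
Qed.

Lemma word_eq_winvr u : word_eq (u ++ winv u) [::].
Proof.
elim: u => [|[x b] u IH] /=; first exact: word_eq_refl.
rewrite /winv /= rev_cons -cats1 catA -cat1s.
apply: (word_eq_trans (word_eq_cat2l _ (word_eq_cat2r _ IH))).
exact: (word_eq_cancel [::] [::]).
Qed.

Lemma word_eq_winvl u : word_eq (winv u ++ u) [::].
Proof. by rewrite -{2}(winvK u); apply: word_eq_winvr. Qed.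

Definition pres_one : presented := \pi_presented [::].
Definition pres_inv (a : presented) : presented := \pi_presented (winv (repr a)).
Definition pres_mul (a b : presented) : presented := \pi_presented (repr a ++ repr b).

Lemma pres_mul_pi u v :
  pres_mul (\pi_presented u) (\pi_presented v) = \pi_presented (u ++ v).
Proof.
apply/pres_eqP; apply: (word_eq_trans (word_eq_cat2r _ (pres_repr u))).
exact/word_eq_cat2l/pres_repr.
Qed.

Lemma pres_mulA : associative pres_mul.
Proof.
move=> a b c; rewrite -[a](@reprK _ presented) -[b](@reprK _ presented).
by rewrite -[c](@reprK _ presented) !pres_mul_pi catA.
Qed.

Lemma pres_mul1 : left_id pres_one pres_mul.
Proof. by move=> a; rewrite -[a]reprK pres_mul_pi. Qed.

Lemma pres_mulr1 : right_id pres_one pres_mul.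
Proof. by move=> a; rewrite -[a]reprK pres_mul_pi cats0. Qed.

Lemma pres_mulV : left_inverse pres_one pres_inv pres_mul.
Proof.
move=> a; rewrite -{2}[a]reprK pres_mul_pi.
exact/pres_eqP/word_eq_winvl.
Qed.

Lemma pres_mulrV : right_inverse pres_one pres_inv pres_mul.
Proof.
move=> a; rewrite -{1}[a]reprK pres_mul_pi.
exact/pres_eqP/word_eq_winvr.
Qed.

HB.instance Definition _ := isGroup.Build presented
  pres_mulA pres_mul1 pres_mulr1 pres_mulV pres_mulrV.

Definition pres_gen (x : X) : presented := \pi_presented [:: (x, false)].

Lemma presM u v : \pi_presented (u ++ v) = \pi_presented u * \pi_presented v.
Proof. by rewrite -pres_mul_pi. Qed.

Lemma pres_pi1 : \pi_presented [::] = 1.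
Proof. by []. Qed.

Lemma presV x : \pi_presented [:: (x, true)] = (pres_gen x)^-1.
Proof.
apply: (mulgI (pres_gen x)); rewrite mulgV -presM -pres_pi1.
exact/pres_eqP/(word_eq_cancel [::] [::]).
Qed.

End Presentation.

Section Lift.
Variables (X : choiceType) (rels : set (seq (X * bool))).
Variables (K : groupType) (f : X -> K).

Definition word_val (u : seq (X * bool)) : K :=
  \big[*%g/1]_(l <- u) (if l.2 then (f l.1)^-1 else f l.1).

Lemma word_val_cat u v : word_val (u ++ v) = word_val u * word_val v.
Proof. exact: big_cat. Qed.

Definition pres_lift (a : presented rels) : K := word_val (repr a).

Hypothesis relsP : forall r, rels r -> word_val r = 1.

Lemma word_val_eq u v : word_eq rels u v -> word_val u = word_val v.
Proof.
elim=> {u v} [//|//|u v w _ -> _ -> //|u v x b|u v r rr].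
  rewrite !word_val_cat; congr (_ * _); rewrite -[RHS]mul1g; congr (_ * _).
  by rewrite /word_val !big_cons big_nil /= mulg1; case: b; rewrite ?mulVg ?mulgV.
by rewrite !word_val_cat (relsP rr) mul1g.
Qed.

Lemma pres_lift_pi u : pres_lift (\pi_(presented rels) u) = word_val u.
Proof. exact/word_val_eq/pres_repr. Qed.

Lemma pres_lift_gen x : pres_lift (pres_gen _ x) = f x.
Proof. by rewrite pres_lift_pi /word_val big_seq1. Qed.

Lemma pres_lift_morphism : monoid.monoid_morphism pres_lift.
Proof.
split=> [|a b]; first by rewrite pres_lift_pi /word_val big_nil.
by rewrite -[a]reprK -[b]reprK -presM !pres_lift_pi word_val_cat.
Qed.

Lemma pres_lift_unique (h : UMagmaMorphism.type (presented rels) K) :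
  (forall x, h (pres_gen _ x) = f x) -> h =1 pres_lift.
Proof.
move=> hf a; rewrite -[a]reprK pres_lift_pi; elim: (repr a) => [|[x b] u IH].
  by rewrite pres_pi1 gmulf1 /word_val big_nil.
rewrite -cat1s presM gmulfM IH word_val_cat; congr (_ * _).
rewrite /word_val big_seq1 /=; case: b; last exact: hf.
by rewrite presV gmulfV hf.
Qed.

End Lift.

Definition freeGroup (r : nat) : groupType :=
  presented (set0 : set (seq ('I_r * bool))).

Definition free_gen r (i : 'I_r) : freeGroup r := pres_gen _ i.

Definition free_lift r (K : groupType) (g : 'I_r -> K) : freeGroup r -> K :=
  @pres_lift _ _ K g.

Section FreeLift.
Variables (r : nat) (K : groupType) (g : 'I_r -> K).

Lemma free_lift_morphism : monoid.monoid_morphism (free_lift g).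
Proof. by apply: pres_lift_morphism. Qed.

HB.instance Definition _ :=
  isUMagmaMorphism.Build (freeGroup r) K (free_lift g) free_lift_morphism.

Lemma free_lift_gen i : free_lift g (free_gen i) = g i.
Proof. by apply: pres_lift_gen. Qed.

End FreeLift.

(* G * H is presented by the elements of G and of H, with the multiplication *)
(* tables of both groups as relators.                                        *)

Inductive freeProd_rel (G H : groupType) : seq ((G + H) * bool) -> Prop :=
| freeProd_rell (a b : G) : freeProd_rel
    [:: (inl a, false); (inl b, false); (inl (a * b), true)]
| freeProd_relr (a b : H) : freeProd_rel
    [:: (inr a, false); (inr b, false); (inr (a * b), true)].

Definition freeProd (G H : groupType) : groupType :=
  presented (@freeProd_rel G H : set (seq ((G + H)%type * bool))).

Definition freeProd_inl (G H : groupType) (a : G) : freeProd G H :=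
  pres_gen _ (inl a).
Definition freeProd_inr (G H : groupType) (b : H) : freeProd G H :=
  pres_gen _ (inr b).

Definition freeProd_lift (G H K : groupType) (f : UMagmaMorphism.type G K)
    (h : UMagmaMorphism.type H K) : freeProd G H -> K :=
  @pres_lift _ _ K (fun s => match s with inl a => f a | inr b => h b end).

Section FreeProdTheory.
Variables G H K : groupType.

Lemma freeProd_inl_morphism : monoid.monoid_morphism (@freeProd_inl G H).
Proof.
suff M : {morph @freeProd_inl G H : a b / a * b}.
  split=> //; apply: (mulgI (freeProd_inl H (1 : G))).
  by rewrite -M mulg1 mulg1.
move=> a b; apply: (mulIg (freeProd_inl H (a * b))^-1).
rewrite mulgV -presV /freeProd_inl /pres_gen.
set u := [:: (_ a, _)]; set v := [:: (_ b, _)]; set t := [:: (_, true)].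
rewrite -(presM _ u v) -(presM _ (u ++ v) t) -pres_pi1.
apply/pres_eqP/word_eq_sym.
exact: (word_eq_rel [::] [::] (freeProd_rell H a b)).
Qed.

HB.instance Definition _ := isUMagmaMorphism.Build G (freeProd G H)
  (@freeProd_inl G H) freeProd_inl_morphism.

Lemma freeProd_inr_morphism : monoid.monoid_morphism (@freeProd_inr G H).
Proof.
suff M : {morph @freeProd_inr G H : a b / a * b}.
  split=> //; apply: (mulgI (freeProd_inr G (1 : H))).
  by rewrite -M mulg1 mulg1.
move=> a b; apply: (mulIg (freeProd_inr G (a * b))^-1).
rewrite mulgV -presV /freeProd_inr /pres_gen.
set u := [:: (_ a, _)]; set v := [:: (_ b, _)]; set t := [:: (_, true)].
rewrite -(presM _ u v) -(presM _ (u ++ v) t) -pres_pi1.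
apply/pres_eqP/word_eq_sym.
exact: (word_eq_rel [::] [::] (freeProd_relr G a b)).
Qed.

HB.instance Definition _ := isUMagmaMorphism.Build H (freeProd G H)
  (@freeProd_inr G H) freeProd_inr_morphism.

Variables (f : UMagmaMorphism.type G K) (h : UMagmaMorphism.type H K).

Lemma freeProd_relP r : freeProd_rel r ->
  word_val (fun s : (G + H)%type => match s with inl a => f a | inr b => h b end)
    r = 1.
Proof.
by case=> a b; rewrite /word_val !big_cons big_nil /= mulg1 gmulfM mulgA mulgV.
Qed.

Lemma freeProd_lift_morphism : monoid.monoid_morphism (freeProd_lift f h).
Proof. exact/pres_lift_morphism/freeProd_relP. Qed.

HB.instance Definition _ := isUMagmaMorphism.Build (freeProd G H) K
  (freeProd_lift f h) freeProd_lift_morphism.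

Lemma freeProd_lift_inl a : freeProd_lift f h (freeProd_inl H a) = f a.
Proof. exact: (pres_lift_gen freeProd_relP). Qed.

Lemma freeProd_lift_inr b : freeProd_lift f h (freeProd_inr G b) = h b.
Proof. exact: (pres_lift_gen freeProd_relP). Qed.

End FreeProdTheory.

Section MixedIdentities.
Variables (G : groupType) (r : nat).
Implicit Type w : freeProd G (freeGroup r).

Definition word_eval (g : 'I_r -> G) : freeProd G (freeGroup r) -> G :=
  freeProd_lift idfun (free_lift g).

Definition is_mixed_identity w : Prop :=
  w <> 1 /\ forall g : 'I_r -> G, word_eval g w = 1.

Definition word_content : freeProd G (freeGroup r) -> freeGroup r :=
  freeProd_lift (one_fun (freeGroup r)) idfun.

End MixedIdentities.

Definition gen_subgroup (G : groupType) (S : set G) : set G :=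
  smallest (fun H : set G => group_closed (mem H)) S.

Definition commutator_subgroup (G : groupType) (A B : set G) : set G :=
  gen_subgroup [set [~ a, b] | a in A & b in B].

Section HomeoI.
Variable R : realType.

(* The coercion from sets to types equips [0, 1] with the topology induced  *)
(* from R.                                                                  *)
Definition unitI : set R := `[0%R, 1%R].

Definition homeomorphism (T U : topologicalType) (f : T -> U) : Prop :=
  continuous f /\
  exists g : U -> T, [/\ cancel f g, cancel g f & continuous g].

(* On an interval, a homeomorphism preserves the orientation when it is     *)
(* increasing.                                                              *)
Definition orientation_preserving (f : unitI -> unitI) : Prop :=
  forall x y : unitI, (\val x < \val y)%R -> (\val (f x) < \val (f y))%R.

Definition is_homeoI (f : unitI -> unitI) : bool :=
  `[< homeomorphism f /\ orientation_preserving f >].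

Definition homeoI := {f : unitI -> unitI | is_homeoI f}.
HB.instance Definition _ := Choice.on homeoI.

Definition homeoI_fun (f : homeoI) : unitI -> unitI := \val f.
Coercion homeoI_fun : homeoI >-> Funclass.

Lemma homeoIP (f : homeoI) : homeomorphism f /\ orientation_preserving f.
Proof. exact/asboolP/(valP f). Qed.

Lemma homeoI_ext (f g : homeoI) : f =1 g -> f = g.
Proof. by move=> fg; apply/val_inj/funext. Qed.

Lemma homeoI_one_subproof : is_homeoI idfun.
Proof.
apply/asboolP; split=> //; split; first by move=> x; exact: cvg_id.
by exists idfun; split=> // x; exact: cvg_id.
Qed.

Definition homeoI_one : homeoI := exist _ idfun homeoI_one_subproof.

Lemma homeoI_mul_subproof (f g : homeoI) : is_homeoI (f \o g).
Proof.
have [[cf [f' [fK f'K cf']]] mf] := homeoIP f.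
have [[cg [g' [gK g'K cg']]] mg] := homeoIP g.
apply/asboolP; split; last by move=> x y xy; apply/mf/mg.
split; first by move=> x; apply: continuous_comp; [exact: cg|exact: cf].
exists (g' \o f'); split; [exact: can_comp|exact: can_comp|].
by move=> x; apply: continuous_comp; [exact: cf'|exact: cg'].
Qed.

Definition homeoI_mul (f g : homeoI) : homeoI :=
  exist _ (f \o g) (homeoI_mul_subproof f g).

Lemma homeoI_inv_exists (f : homeoI) :
  exists g : homeoI, cancel f g /\ cancel g f.
Proof.
have [[cf [g [fK gK cg]]] mf] := homeoIP f.
suff hg : is_homeoI g by exists (exist _ g hg).
apply/asboolP; split; first by split=> //; exists f.
move=> x y xy; rewrite ltNge; apply/negP; rewrite le_eqVlt => /orP[/eqP e|].
  by move: xy; rewrite -[x]gK -[y]gK (val_inj e) ltxx.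
by move=> /mf; rewrite !gK => /(lt_trans xy); rewrite ltxx.
Qed.

Definition homeoI_inv (f : homeoI) : homeoI := xget homeoI_one
  [set g : homeoI | cancel f g /\ cancel g f].

Lemma homeoI_invP (f : homeoI) :
  cancel f (homeoI_inv f) /\ cancel (homeoI_inv f) f.
Proof.
have [g gP] := homeoI_inv_exists f.
rewrite /homeoI_inv; case: xgetP => [h _ //|no].
by case: (no g).
Qed.

Lemma homeoI_mulA : associative homeoI_mul.
Proof. by move=> f g h; apply: homeoI_ext. Qed.

Lemma homeoI_mul1 : left_id homeoI_one homeoI_mul.
Proof. by move=> f; apply: homeoI_ext. Qed.

Lemma homeoI_mulr1 : right_id homeoI_one homeoI_mul.
Proof. by move=> f; apply: homeoI_ext. Qed.

Lemma homeoI_mulV : left_inverse homeoI_one homeoI_inv homeoI_mul.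
Proof. by move=> f; apply: homeoI_ext; exact: (homeoI_invP f).1. Qed.

Lemma homeoI_mulrV : right_inverse homeoI_one homeoI_inv homeoI_mul.
Proof. by move=> f; apply: homeoI_ext; exact: (homeoI_invP f).2. Qed.

HB.instance Definition _ := isGroup.Build homeoI
  homeoI_mulA homeoI_mul1 homeoI_mulr1 homeoI_mulV homeoI_mulrV.

End HomeoI.

(* Main.v *)
From HB Require Import structures.
Require Import Defs.
From mathcomp Require Import all_boot all_order all_algebra.
From mathcomp Require Import all_classical all_reals all_analysis.
From mathcomp Require Import ring lra.

(* Only the nontriviality of the content v of w matters. Near the endpoint 1, *)
(* choose a coordinate phi : [0, 1) -> [0, oo) so coarse that every constant  *)
(* of w moves points by at most eps. If the letters are replaced by maps g_i  *)
(* that are bi-Lipschitz in this coordinate, the constants contribute only an *)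
(* error C eps, with C depending on w and on the Lipschitz constant alone:    *)
(* w(g) and v(g) are C eps-close. On the other hand, writing v as a reduced   *)
(* word of length n > 0 along the path 1, 2, ..., n+1 of the half-line gives  *)
(* partial monotone maps of the integers, which extend to piecewise linear    *)
(* homeomorphisms g_i with Lipschitz constant 3 such that v(g) sends n+1 to   *)
(* 1. For eps small this is incompatible with w(g) = 1.                       *)

Set Implicit Arguments.
Unset Strict Implicit.
Unset Printing Implicit Defensive.

Import Order.TTheory GRing.Theory Num.Theory numFieldNormedType.Exports.

Local Open Scope classical_set_scope.
Local Open Scope ring_scope.

(** The word is compared with its content in a coordinate on [0,1). By [word_eval_content],
    replacing all constants by 1 changes the value by at most C eps, where C is fixed before the
    coordinate and the maps are chosen. [fine_chart] therefore supplies a coordinate with eps =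
    1/(C+1), so the change stays below 1. In any chart, [chart_path_lipschitz] builds maps which,
    with their inverses, are 3-Lipschitz, and by [word_val_path] the content, written as a reduced
    word of length n, then moves a point by exactly n >= 1. So w cannot take the value 1 there;
    [content_not_mixed_identity] combines these facts. *)

(** * Piecewise linear interpolation on the half-line *)

Section PiecewiseLinear.
Variable R : realType.
Implicit Types (u : nat -> R) (y z : R).

Definition pl u z : R :=
  let k := Num.truncn z in u k + (z - k%:R) * (u k.+1 - u k).

Lemma plE u k z : k%:R <= z <= k.+1%:R ->
  pl u z = u k + (z - k%:R) * (u k.+1 - u k).
Proof.
case/andP=> kz; rewrite le_eqVlt => /orP[/eqP->|zk].
  by rewrite /pl natrK -natr1; ring.
by rewrite /pl (@truncn_def _ z k) ?kz.
Qed.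

Lemma pl_nat u k : pl u k%:R = u k.
Proof. by rewrite (@plE _ k) ?subrr ?mul0r ?addr0 // lexx ler_nat leqnSn. Qed.

Lemma pl_affine a b u z :
  pl (fun k => a * k%:R + b * u k) z = a * z + b * pl u z.
Proof. by rewrite /pl -natr1; ring. Qed.

Lemma pl_itv u z : {homo u : m n / (m <= n)%N >-> m <= n} -> 0 <= z ->
  u (Num.truncn z) <= pl u z <= u (Num.truncn z).+1.
Proof.
move=> uM z0; have /andP[kz zk] := truncn_itv z0.
have := uM _ _ (leqnSn (Num.truncn z)).
by rewrite /pl; move: zk; rewrite -natr1 => zk uk; nra.
Qed.

Lemma pl_le u : {homo u : m n / (m <= n)%N >-> m <= n} ->
  {in Num.nneg &, {homo pl u : y z / y <= z}}.
Proof.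
move=> uM y z; rewrite !nnegrE => y0 z0 yz.
have /andP[_ yu] := pl_itv uM y0; have /andP[uz _] := pl_itv uM z0.
have := le_truncn yz; rewrite leq_eqVlt => /orP[/eqP kk|kk].
  rewrite /pl kk lerD2l ler_wpM2r ?lerD2r // subr_ge0.
  exact/uM/leqnSn.
exact: (le_trans yu (le_trans (uM _ _ kk) uz)).
Qed.

Lemma pl_lt u : {homo u : m n / (m < n)%N >-> m < n} ->
  {in Num.nneg &, {homo pl u : y z / y < z}}.
Proof.
move=> uM y z; rewrite !nnegrE => y0 z0 yz.
have uW : {homo u : m n / (m <= n)%N >-> m <= n}.
  by move=> m n; rewrite leq_eqVlt => /orP[/eqP->//|/uM/ltW].
have /andP[uz _] := pl_itv uW z0.
have := le_truncn (ltW yz); rewrite leq_eqVlt => /orP[/eqP kk|kk].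
  rewrite /pl kk ltrD2l ltr_pM2r ?ltrD2r // subr_gt0.
  exact/uM/ltnSn.
apply: lt_le_trans (le_trans (uW _ _ kk) uz).
rewrite /pl; have := uM _ _ (ltnSn (Num.truncn y)).
have /andP[] := truncn_itv y0; rewrite -natr1; nra.
Qed.

Lemma pl_surj u y : {homo u : m n / (m < n)%N >-> m < n} ->
  u 0%N <= y -> (exists k, y < u k) -> exists2 z, 0 <= z & pl u z = y.
Proof.
move=> uM y0 yk; case: (ex_minnP yk) => -[|k] yuk kmin.
  by move: (le_lt_trans y0 yuk); rewrite ltxx.
have uky : u k <= y by rewrite leNgt; apply/negP => /kmin; rewrite ltnn.
have d0 : 0 < u k.+1 - u k by rewrite subr_gt0; exact/uM.
have q0 : 0 <= (y - u k) / (u k.+1 - u k).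
  by apply: divr_ge0; [rewrite subr_ge0|exact: ltW].
have q1 : (y - u k) / (u k.+1 - u k) <= 1.
  by rewrite ler_pdivrMr // mul1r lerD2r ltW.
exists (k%:R + (y - u k) / (u k.+1 - u k)); first by rewrite addr_ge0.
rewrite (@plE _ k); last by rewrite -natr1 lerDl q0 lerD2l.
by rewrite [k%:R + _]addrC addrK divfK ?gt_eqF // addrC subrK.
Qed.

(** The functions [pl u z - m * z] and [M * z - pl u z] are again interpolations, by [pl_affine],
    with nondecreasing nodes; [pl_le] makes them monotone. *)
Lemma pl_bilipschitz u (m M : R) :
  (forall k, m <= u k.+1 - u k <= M) ->
  {in Num.nneg &, forall y z,
    y <= z -> m * (z - y) <= pl u z - pl u y <= M * (z - y)}.
Proof.
move=> du y z y0 z0 yz.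
have h a b (v := fun k => a * k%:R + b * u k) :
    (forall k, v k <= v k.+1) -> a * y + b * pl u y <= a * z + b * pl u z.
  move=> vS; rewrite -!pl_affine; apply: pl_le => //.
  by apply: homo_leq vS => //; exact: le_trans.
have hm : - m * y + 1 * pl u y <= - m * z + 1 * pl u z.
  by apply: h => k; have /andP[] := du k; rewrite -natr1; lra.
have hM : M * y + (-1) * pl u y <= M * z + (-1) * pl u z.
  by apply: h => k; have /andP[] := du k; rewrite -natr1; lra.
by lra.
Qed.

End PiecewiseLinear.

(** * Increasing bijections of [0,1] are homeomorphisms *)

Lemma unitI_itv (R : realType) (x : @unitI R) : \val x \in `[0, 1].
Proof. by have := valP x; rewrite inE. Qed.

Lemma increasing_surj_continuous (R : realType) (f f' : @unitI R -> @unitI R) :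
  (forall x y, \val x < \val y -> \val (f x) < \val (f y)) -> cancel f' f ->
  continuous f.
Proof.
move=> flt f'K.
have I0 : (0 : R) \in @unitI R by rewrite inE /unitI /= in_itv /= lexx ler01.
(* Transports [f] to a real function, where an increasing map onto a segment is known to be
   continuous; the default 0 outside [0,1] is never seen. *)
pose clamp (x : R) : @unitI R := insubd (exist _ 0 I0 : @unitI R) x.
have clampK (x : @unitI R) : clamp (\val x) = x by exact: valKd.
have clampE (x : R) : x \in `[0, 1] -> \val (clamp x) = x.
  by move=> xI; rewrite insubdK // inE.
pose F (x : R) := \val (f (clamp x)).
have Flt : {in `[0, 1] &, {homo F : x y / x < y}}.
  by move=> x y xI yI xy; apply: flt; rewrite !clampE.
have Fsurj : set_surj `[0, 1] `[F 0, F 1] F.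
  move=> y /= yI.
  have yU : y \in @unitI R.
    rewrite inE; move: yI (unitI_itv (f (clamp 0))) (unitI_itv (f (clamp 1))).
    rewrite /unitI /= !in_itv /= => /andP[y0 y1] /andP[F0 _] /andP[_ F1].
    by rewrite (le_trans F0 y0) (le_trans y1 F1).
  exists (\val (f' (exist _ y yU))); first exact: unitI_itv.
  by rewrite /F clampK f'K.
have := segment_inc_surj_continuous (le_mono_in Flt) Fsurj.
move/subspace_sigL_continuousP => cF.
apply: continuous_comp_initial.
rewrite (_ : _ \o f = sigL `[0, 1] F) //.
by apply/funext => x /=; rewrite /F clampK.
Qed.

Lemma increasing_homeoI (R : realType) (F : R -> R) :
  {in `[0, 1] &, {homo F : x y / x < y}} ->
  {homo F : x / x \in `[0, 1]} ->
  {in `[0, 1], forall y, exists2 x, x \in `[0, 1] & F x = y} ->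
  exists g : homeoI R, forall x, \val (g x) = F (\val x).
Proof.
move=> Flt Fin Fsurj.
have Fmem (x : @unitI R) : F (\val x) \in @unitI R.
  by rewrite inE; exact: Fin (unitI_itv x).
pose f (x : @unitI R) : @unitI R := exist _ (F (\val x)) (Fmem x).
have F'P (y : @unitI R) : exists x : @unitI R, f x = y.
  have [x xI xy] := Fsurj _ (unitI_itv y).
  have xU : x \in @unitI R by rewrite inE.
  by exists (exist _ x xU); apply: val_inj.
have [f' f'K] := choice F'P.
have flt (x y : @unitI R) : \val x < \val y -> \val (f x) < \val (f y).
  exact: Flt (unitI_itv x) (unitI_itv y).
have f'lt (x y : @unitI R) : \val x < \val y -> \val (f' x) < \val (f' y).
  rewrite -{1}(f'K x) -{1}(f'K y) !ltNge; apply: contra.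
  by rewrite le_eqVlt => /orP[/eqP/val_inj->//|/flt/ltW].
have fK : cancel f f'.
  move=> x; apply: val_inj; apply/eqP; rewrite eq_le !leNgt.
  by apply/andP; split; apply/negP => /flt; rewrite f'K ltxx.
have fI : is_homeoI f.
  apply/asboolP; split; last exact: flt.
  split; first exact: increasing_surj_continuous f'K.
  by exists f'; split=> //; exact: increasing_surj_continuous f'lt fK.
by exists (exist _ f fI).
Qed.

Section HomeoIFacts.
Variable R : realType.
Implicit Types (f g : homeoI R) (x y : @unitI R).

Lemma homeoI_mulE f g x : ((f * g)%g : homeoI R) x = f (g x).
Proof. by []. Qed.

Lemma homeoI_invK f : cancel f ((f^-1)%g : homeoI R).
Proof. by move=> x; rewrite -homeoI_mulE mulVg. Qed.

Lemma homeoI_invKV f : cancel ((f^-1)%g : homeoI R) f.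
Proof. by move=> x; rewrite -homeoI_mulE mulgV. Qed.

Lemma homeoI_le f x y : \val x <= \val y -> \val (f x) <= \val (f y).
Proof.
by rewrite le_eqVlt => /orP[/eqP/val_inj->//|/((homeoIP f).2)/ltW].
Qed.

Lemma homeoI_lt1 f x : \val x < 1 -> \val (f x) < 1.
Proof.
have I1 : (1 : R) \in @unitI R by rewrite inE /unitI /= in_itv /= lexx ler01.
move=> x1; have := (homeoIP f).2 x (exist _ 1 I1) x1.
move/lt_le_trans; apply.
by have := unitI_itv (f (exist _ 1 I1)); rewrite in_itv => /andP[].
Qed.

End HomeoIFacts.

(** * Coordinates on [0,1) in which given constants move points little *)

Section Charts.
Variable R : realType.
Implicit Types e phi : R -> R.

Definition chart e phi : Prop :=
  [/\ {in Num.nneg &, {homo e : y z / y < z}},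
      forall z : R, 0 <= z -> 0 <= e z < 1 /\ phi (e z) = z
    & forall x : R, 0 <= x < 1 -> 0 <= phi x /\ e (phi x) = x].

Lemma chart_exists e :
  {in Num.nneg &, {homo e : y z / y < z}} ->
  (forall z : R, 0 <= z -> 0 <= e z < 1) ->
  (forall x : R, 0 <= x < 1 -> exists2 z, 0 <= z & e z = x) ->
  exists phi, chart e phi.
Proof.
move=> elt ein esurj.
have phiP x : exists z, 0 <= x < 1 -> 0 <= z /\ e z = x.
  have [/esurj[z z0 zx]|_] := boolP (0 <= x < 1); first by exists z.
  by exists 0.
have [phi phiK] := choice phiP.
exists phi; split=> // z z0; split; first exact: ein.
have [p0 pz] := phiK _ (ein _ z0).
apply: (inc_inj_in (le_mono_in elt)) => //; exact: pz.
Qed.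

Section ChartTheory.
Variables (e phi : R -> R).
Hypothesis ephi : chart e phi.

Lemma chart_lt x y : 0 <= x < 1 -> 0 <= y < 1 -> x < y -> phi x < phi y.
Proof.
case: ephi => elt _ phiP => /phiP[px ex] /phiP[py ey]; rewrite !ltNge.
apply: contra; rewrite -{2}ex -{2}ey.
by rewrite le_eqVlt => /orP[/eqP->//|/elt]; rewrite !nnegrE => /(_ py px)/ltW.
Qed.

(** The conjugate of [pl a] by the chart is an increasing bijection of [0,1), since
    [pl a z >= m * z] is unbounded; adding the fixed point 1 gives a homeomorphism. *)
Lemma chart_conj (a : nat -> R) (m M : R) :
  a 0%N = 0 -> 0 < m -> (forall k, m <= a k.+1 - a k <= M) ->
  exists g : homeoI R,
    forall x : @unitI R, \val x < 1 -> phi (\val (g x)) = pl a (phi (\val x)).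
Proof.
move=> a0 m0 da; have [elt eP phiP] := ephi.
have alt : {homo a : k l / (k < l)%N >-> k < l}.
  apply: (@homo_ltn _ a (fun x y => x < y)) => [? ? ?|k]; first exact: lt_trans.
  by have /andP[+ _] := da k; rewrite -subr_gt0; apply: lt_le_trans.
have pl_ge z : 0 <= z -> m * z <= pl a z.
  move=> z0; have := @pl_bilipschitz R a m M da 0 z.
  rewrite !nnegrE lexx z0 => /(_ isT isT isT) /andP[+ _].
  by rewrite (pl_nat a 0) a0 !subr0.
have pa0 z : 0 <= z -> 0 <= pl a z.
  by move=> z0; apply: le_trans (pl_ge _ z0); rewrite mulr_ge0 // ltW.
have ain x : 0 <= x < 1 -> 0 <= e (pl a (phi x)) < 1.
  by move=> /phiP[px _]; have [] := eP _ (pa0 _ px).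
pose F x := if x < 1 then e (pl a (phi x)) else x.
have itv01 (x : R) : (x \in `[0, 1]) = (0 <= x <= 1) by rewrite in_itv.
have itvS (x : R) : x \in `[0, 1] -> x < 1 -> 0 <= x < 1.
  by rewrite itv01 => /andP[-> _].
have [||y|g gF] := @increasing_homeoI R F.
- move=> x y xI yI xy; have x1 : x < 1.
    by apply: lt_le_trans xy _; move: yI; rewrite itv01 => /andP[].
  rewrite /F x1; case: ifP => [y1|/negbT].
    have [[px _] [py _]] := (phiP _ (itvS _ xI x1), phiP _ (itvS _ yI y1)).
    apply: elt; rewrite ?nnegrE ?pa0 //.
    by apply: pl_lt; rewrite ?nnegrE // chart_lt // itvS.
  by rewrite -leNgt; apply: lt_le_trans; have /andP[] := ain _ (itvS _ xI x1).
- move=> x xI; rewrite /F; case: ifP => // x1.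
  by have /andP[F0 F1] := ain _ (itvS _ xI x1); rewrite itv01 F0 ltW.
- move=> yI; have [y1|y1] := ltP y 1; last first.
    by exists y; rewrite // /F ltNge y1.
  have [py ey] := phiP _ (itvS _ yI y1).
  have [||z z0 az] := @pl_surj R a (phi y) alt; first by rewrite a0.
    exists (Num.truncn (phi y / m)).+1.
    rewrite -(pl_nat a); apply: lt_le_trans (pl_ge _ (ler0n _ _)).
    by rewrite mulrC -ltr_pdivrMr // truncnS_gt.
  have [/andP[e0 e1] pez] := eP _ z0.
  by exists (e z); rewrite ?itv01 ?e0 ?ltW // /F e1 pez az.
exists g => x x1; rewrite gF /F x1.
have [px _] := phiP _ (itvS _ (unitI_itv x) x1).
by have [_ ->] := eP _ (pa0 _ px).
Qed.

End ChartTheory.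

(** The bound is the largest of the finitely many values at [t] and of [(1 + t) / 2]; the latter
    makes the iterates tend to 1. *)
Lemma homeoI_bound (ds : seq (homeoI R)) (t : R) : 0 <= t < 1 ->
  exists y, [/\ (1 + t) / 2 <= y, y < 1 &
    forall (c : homeoI R) (p : @unitI R),
      c \in ds -> \val p <= t -> \val (c p) <= y].
Proof.
move=> /andP[t0 t1].
have tU : t \in @unitI R by rewrite inE /unitI /= in_itv /= t0 ltW.
pose q : @unitI R := exist _ t tU.
elim: ds => [|d ds [y [ty y1 yP]]].
  by exists ((1 + t) / 2); split=> //; lra.
exists (Num.max y (\val (d q))); split; first by rewrite le_max ty.
  by rewrite gt_max y1 /= homeoI_lt1.
move=> c p; rewrite inE => /predU1P[->|cds] pt; rewrite le_max.
  by rewrite (@homeoI_le _ _ p q) ?orbT.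
by rewrite yP.
Qed.

(* The breakpoints t_k are chosen so that c(t_k) <= t_(k+1) for each constant *)
(* c and its inverse: in the piecewise linear coordinate sending t_k to k,    *)
(* every constant moves points by at most 2.                                  *)
Lemma fine_chart (cs : seq (homeoI R)) (eps : R) : 0 < eps ->
  exists e phi, chart e phi /\ forall (c : homeoI R) (x : @unitI R),
    c \in cs -> \val x < 1 -> `|phi (\val (c x)) - phi (\val x)| <= eps.
Proof.
(* With inverses included, one-sided estimates suffice. *)
move=> eps0; pose ds := cs ++ [seq (c^-1)%g | c <- cs].
have /choice[next nextP] (t : R) : exists y, 0 <= t < 1 ->
    [/\ (1 + t) / 2 <= y, y < 1 & forall (c : homeoI R) (p : @unitI R),
      c \in ds -> \val p <= t -> \val (c p) <= y].
  have [/(homeoI_bound ds)[y yP]|_] := boolP (0 <= t < 1); first by exists y.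
  by exists 0.
pose t k := iter k next 0.
have tE k : t k.+1 = next (t k) by [].
have t01 k : 0 <= t k < 1.
  elim: k => [|k IH]; first by rewrite /= lexx ltr01.
  have [ty y1 _] := nextP _ IH.
  by move: IH => /andP[t0 t1]; rewrite tE y1 andbT; lra.
have tS k : (1 + t k) / 2 <= t k.+1 by have [] := nextP _ (t01 k).
have tlt : {homo t : k l / (k < l)%N >-> k < l}.
  apply: (@homo_ltn _ t (fun x y => x < y)) => [? ? ?|k]; first exact: lt_trans.
  by have := tS k; have /andP[_ +] := t01 k; lra.
(* Each step at least halves [1 - t k], while k+2 <= 2(k+1): so [(1 - t k) * k.+1%:R] never exceeds
   its initial value 1. *)
have t_cvg k : 1 - t k <= k.+1%:R^-1.
  have -> : 1 - t k = ((1 - t k) * k.+1%:R) / k.+1%:R.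
    by rewrite mulfK ?pnatr_eq0.
  rewrite ler_piMl ?invr_ge0 //.
  elim: k => [|k IH]; first by rewrite /= subr0 mulr1.
  apply: le_trans IH.
  have d0 : 0 <= 1 - t k by rewrite subr_ge0; have /andP[_ /ltW] := t01 k.
  apply: (@le_trans _ _ ((1 - t k) / 2 * k.+2%:R)).
    by rewrite ler_wpM2r //; have := tS k; lra.
  rewrite -mulrA ler_wpM2l // -[k.+2%:R]natr1 -[k.+1%:R]natr1.
  by have := ler0n R k; lra.
(* Dividing the coordinate by [N] turns a displacement of 2 into one of [eps]. *)
pose N := 2 / eps; have N0 : 0 < N by rewrite divr_gt0.
pose e z := pl t (N * z).
have tle : {homo t : k l / (k <= l)%N >-> k <= l}.
  by move=> k l; rewrite leq_eqVlt => /predU1P[->//|/tlt/ltW].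
have elt : {in Num.nneg &, {homo e : y z / y < z}}.
  move=> y z; rewrite !nnegrE => y0 z0 yz; apply: pl_lt => //.
  - by rewrite nnegrE mulr_ge0 // ltW.
  - by rewrite nnegrE mulr_ge0 // ltW.
  - by rewrite ltr_pM2l.
have [|x /andP[x0 x1]|phi ephi] := @chart_exists e elt.
- move=> z z0; have Nz : 0 <= N * z by rewrite mulr_ge0 // ltW.
  have /andP[lo hi] := pl_itv tle Nz.
  have /andP[a0 _] := t01 (Num.truncn (N * z)).
  have /andP[_ b1] := t01 (Num.truncn (N * z)).+1.
  by rewrite (le_trans a0 lo) (le_lt_trans hi b1).
- have [//||z z0 zx] := @pl_surj R t x tlt.
    exists (Num.truncn (1 - x)^-1).
    have := t_cvg (Num.truncn (1 - x)^-1).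
    have : (Num.truncn (1 - x)^-1).+1%:R^-1 < 1 - x.
      by rewrite invf_plt ?posrE ?subr_gt0 ?ltr0n // truncnS_gt.
    by move=> h /le_lt_trans/(_ h); rewrite ltrD2l ltrN2.
  exists (z / N); first by rewrite divr_ge0 // ltW.
  by rewrite /e mulrC divfK // gt_eqF.
exists e, phi; split=> //.
have [_ _ phiP] := ephi.
have vP (x : @unitI R) : \val x < 1 -> 0 <= \val x < 1.
  by move=> ->; have := unitI_itv x; rewrite in_itv /= => /andP[-> _].
have up (c : homeoI R) (x : @unitI R) :
    c \in ds -> \val x < 1 -> phi (\val (c x)) <= phi (\val x) + eps.
  move=> cd x1; have [px ex] := phiP _ (vP _ x1).
  have [pc ec] := phiP _ (vP _ (homeoI_lt1 c x1)).
  have Nx : 0 <= N * phi (\val x) by rewrite mulr_ge0 // ltW.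
  set k := Num.truncn (N * phi (\val x)).
  (* A point below [t k.+1] goes below [t k.+2], so a rescaled coordinate at least k becomes at most
     k+2. *)
  have xk : \val x <= t k.+1 by rewrite -ex; have /andP[] := pl_itv tle Nx.
  have ck : \val (c x) <= t k.+2 by have [_ _] := nextP _ (t01 k.+1); exact.
  have Nc : N * phi (\val (c x)) <= k.+2%:R.
    rewrite leNgt; apply/negP => kc; move: ck; rewrite leNgt => /negP; apply.
    rewrite -[X in _ < X]ec -(pl_nat t); apply: pl_lt => //.
      by rewrite nnegrE.
    by rewrite nnegrE mulr_ge0 // ltW.
  have kx : k%:R <= N * phi (\val x) by have /andP[] := truncn_itv Nx.
  suff : N * phi (\val (c x)) <= N * (phi (\val x) + eps) by rewrite ler_pM2l.
  rewrite mulrDr {3}/N divfK ?gt_eqF //.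
  by move: Nc; rewrite -[k.+2%:R]natr1 -[k.+1%:R]natr1; lra.
move=> c x cc x1; rewrite ler_distl.
have cV : (c^-1)%g \in ds by rewrite mem_cat map_f ?orbT.
(* The lower bound is the upper bound for the inverse of [c] at the point [c x]. *)
have := up _ _ cV (homeoI_lt1 c x1); rewrite homeoI_invK => lo.
rewrite up // ?mem_cat ?cc // andbT; lra.
Qed.

End Charts.

(** * Comparison of a word with its content *)

Section Words.
Variable R : realType.

Lemma word_val_cons (X : choiceType) (K : groupType) (f : X -> K) l u :
  word_val f (l :: u) = ((if l.2 then (f l.1)^-1 else f l.1) * word_val f u)%g.
Proof. by rewrite /word_val big_cons. Qed.

(** A representative of minimal length is reduced: deleting a cancelling pair would shorten it. *)
Lemma reduced_repr (r : nat) (v : freeGroup r) :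
  exists2 u : seq ('I_r * bool), v = \pi_(freeGroup r)%qT u &
    forall s1 x b s2, u <> s1 ++ [:: (x, b), (x, ~~ b) & s2].
Proof.
pose P n := `[< exists u : seq ('I_r * bool),
  size u = n /\ v = \pi_(freeGroup r)%qT u >].
have exP : exists n, P n.
  by exists (size (repr v)); apply/asboolP; exists (repr v); rewrite reprK.
case: (ex_minnP exP) => n /asboolP[u [un vu]] nmin.
exists u => // s1 x b s2 us; have : P (size (s1 ++ s2)).
  apply/asboolP; exists (s1 ++ s2); split=> //; rewrite vu us.
  exact/pres_eqP/word_eq_cancel.
by move/nmin; rewrite -un us !size_cat /= !addnS ltnNge leqnSn.
Qed.

Definition lipschitz_in (phi : R -> R) (K : R) (h : homeoI R) : Prop :=
  forall x y : @unitI R, \val x < 1 -> \val y < 1 ->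
    `|phi (\val (h x)) - phi (\val (h y))| <=
    K * `|phi (\val x) - phi (\val y)|.

Lemma lipschitz_word_val phi (X : choiceType) (g : X -> homeoI R) (K : R)
    (u : seq (X * bool)) : 0 <= K ->
  (forall i, lipschitz_in phi K (g i) /\ lipschitz_in phi K (g i)^-1%g) ->
  lipschitz_in phi (K ^+ size u) (word_val g u).
Proof.
move=> K0 gK; elim: u => [|[i b] u IH] x y x1 y1.
  by rewrite /word_val big_nil mul1r.
rewrite word_val_cons exprS -mulrA.
apply: le_trans (ler_wpM2l K0 (IH _ _ x1 y1)).
by case: b; [apply: (gK i).2|apply: (gK i).1]; apply: homeoI_lt1.
Qed.

(** Induction on a word representing [w]: a constant on the left adds [eps] to the error, and a free
    group element on the left multiplies it by [K] to the length of that element. *)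
Lemma word_eval_content r (w : freeProd (homeoI R) (freeGroup r)) (K : R) :
  0 <= K ->
  exists (C : R) (cs : seq (homeoI R)), 0 <= C /\
  forall phi (eps : R) (g : 'I_r -> homeoI R),
    0 <= eps ->
    (forall i, lipschitz_in phi K (g i) /\ lipschitz_in phi K (g i)^-1%g) ->
    (forall (c : homeoI R) (x : @unitI R), c \in cs -> \val x < 1 ->
      `|phi (\val (c x)) - phi (\val x)| <= eps) ->
    forall x : @unitI R, \val x < 1 ->
      `|phi (\val ((word_eval g w : homeoI R) x)) -
        phi (\val ((free_lift g (word_content w) : homeoI R) x))| <= C * eps.
Proof.
move=> K0; rewrite /word_eval /word_content /freeProd_lift /pres_lift.
pose evalf (g : 'I_r -> homeoI R) s :=
  match s with inl c => idfun c | inr b => free_lift g b end.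
elim: (repr w) => [|[[c|b] s] u [C [cs [C0 IH]]]].
- exists 0, [::]; split=> // phi eps g _ _ _ x _.
  by rewrite /word_val !big_nil gmulf1 subrr normr0 mul0r.
- exists (C + 1), ((if s then c^-1 else c)%g :: cs).
  split; first by rewrite addr_ge0.
  move=> phi eps g e0 gK cse x x1; rewrite !word_val_cons /=.
  have -> : (if s then 1^-1 else 1 : freeGroup r)%g = 1%g.
    by case: (s); rewrite ?invg1.
  rewrite mul1g.
  have cse' : forall (c : homeoI R) (x : @unitI R), c \in cs -> \val x < 1 ->
      `|phi (\val (c x)) - phi (\val x)| <= eps.
    by move=> d y dcs; apply: cse; rewrite inE dcs orbT.
  rewrite homeoI_mulE mulrDl mul1r [leRHS]addrC.
  pose y := (word_val (evalf g) u : homeoI R) x.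
  apply: le_trans (ler_distD (phi (\val y)) _ _) _.
  apply: lerD; last exact: (IH phi eps g).
  by apply: cse; [exact: mem_head|exact: homeoI_lt1].
- pose b' := (if s then b^-1 else b)%g.
  exists (K ^+ size (repr b') * C), cs.
  split; first by rewrite mulr_ge0 ?exprn_ge0.
  move=> phi eps g e0 gK cse x x1; rewrite !word_val_cons /=.
  have -> : (if s then (free_lift g b)^-1 else free_lift g b)%g =
    free_lift g b'.
    by rewrite /b'; case: (s) => //; rewrite gmulfV.
  rewrite -/b' gmulfM !homeoI_mulE -mulrA.
  have lip : lipschitz_in phi (K ^+ size (repr b')) (free_lift g b').
    exact: lipschitz_word_val.
  apply: le_trans (lip _ _ (homeoI_lt1 _ x1) (homeoI_lt1 _ x1)) _.
  by rewrite ler_wpM2l ?exprn_ge0 // IH.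
Qed.

(** * Writing a reduced word along a path of integers *)

Section ReducedPath.
Variables (r : nat) (u : seq ('I_r * bool)).
Hypothesis u_reduced : forall s1 x b s2, u <> s1 ++ [:: (x, b), (x, ~~ b) & s2].

(* [label k.+1] is the label of the edge {k, k+1} of the half-line; the word  *)
(* [u] is written on the edges {1, 2}, ..., {n, n+1}, where n = size u.       *)
Definition label k := nth None [:: None, None & map Some u] k.

Lemma label_reduced k i b :
  label k = Some (i, b) -> label k.+1 <> Some (i, ~~ b).
Proof.
case: k => [//|[//|k]]; rewrite /label /= => hk hk1.
have sk1 : (k.+1 < size u)%N.
  by rewrite ltnNge; apply/negP => h; rewrite nth_default ?size_map in hk1.
have sk := ltnW sk1.
rewrite (nth_map (i, b)) // in hk; rewrite (nth_map (i, b)) // in hk1.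
case: hk hk1 => hk [hk1]; apply: (@u_reduced (take k u) i b (drop k.+2 u)).
rewrite -[LHS](cat_take_drop k) (drop_nth (i, b)) // (drop_nth (i, b) sk1).
by rewrite hk hk1.
Qed.

(* The generator i must send k+1 to k if the edge {k, k+1} is labelled x_i,   *)
(* and k to k+1 if it is labelled x_i^-1; at the remaining integers the       *)
(* displacements 1/3, -1/3 or 0 keep the map increasing.                      *)
Definition path_node (i : 'I_r) k : R :=
  k%:R + if label k.+1 == Some (i, true) then 1
         else if label k == Some (i, false) then -1
         else if label k == Some (i, true) then 3^-1
         else if label k.+1 == Some (i, false) then - 3^-1
         else 0.

Lemma path_node0 i : path_node i 0 = 0.
Proof. by rewrite /path_node addr0. Qed.

(** Reducedness excludes the label pairs that would make two prescribed values clash. A displacement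
    1 at k forces at least 1/3 at k+1, and -1 at k+1 forces at most -1/3 at k; the upper bound 3
    comes from -1 followed by 1. *)
Lemma path_node_incr i k : 3^-1 <= path_node i k.+1 - path_node i k <= 3.
Proof.
have noUD j b :
    (label j == Some (i, b)) && (label j.+1 == Some (i, ~~ b)) = false.
  by apply/negP => /andP[/eqP/label_reduced h /eqP/h].
have disj j :
    (label j == Some (i, true)) && (label j == Some (i, false)) = false.
  by apply/negP => /andP[/eqP-> /eqP].
rewrite /path_node -[k.+1%:R]natr1.
move: (noUD k true) (noUD k false) (noUD k.+1 true) (noUD k.+1 false).
move: (disj k) (disj k.+1) (disj k.+2) => /=.
do !case: (_ == _) => //=; lra.
Qed.

Lemma path_node_down i k :
  label k.+1 = Some (i, false) -> path_node i k.+1 = k%:R.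
Proof.
move=> l; rewrite /path_node l eqxx.
case: eqP => [/(label_reduced l) //|_].
by rewrite -natr1 addrK.
Qed.

Lemma path_node_up i k : label k.+1 = Some (i, true) -> path_node i k = k.+1%:R.
Proof. by move=> l; rewrite /path_node l eqxx natr1. Qed.

(** The product is composition, so the last letter acts first; each letter lowers the index by one,
    and the induction runs over suffixes of [u]. *)
Lemma word_val_path (g : 'I_r -> homeoI R) (P : nat -> @unitI R) :
  (forall i k l, path_node i k = l%:R -> g i (P k) = P l) ->
  (word_val g u : homeoI R) (P (size u).+1) = P 1%N.
Proof.
move=> gP; suff h s1 s2 : u = s1 ++ s2 ->
    (word_val g s2 : homeoI R) (P (size u).+1) = P (size s1).+1.
  exact: (h [::]).
elim: s2 s1 => [|[i b] s2 IH] s1 us.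
  by rewrite /word_val big_nil us cats0.
rewrite word_val_cons homeoI_mulE (IH (rcons s1 (i, b))) ?cat_rcons //.
rewrite size_rcons.
have l : label (size s1).+2 = Some (i, b).
  by rewrite /label us map_cat /= nth_cat size_map ltnn subnn.
case: b l us => /= l us; last exact/gP/path_node_down.
by rewrite -(gP _ _ _ (path_node_up l)); exact: homeoI_invK.
Qed.

End ReducedPath.

Lemma chart_path_lipschitz r (u : seq ('I_r * bool)) e phi : chart e phi ->
  (forall s1 x b s2, u <> s1 ++ [:: (x, b), (x, ~~ b) & s2]) ->
  exists g : 'I_r -> homeoI R,
    (forall i, lipschitz_in phi 3 (g i) /\ lipschitz_in phi 3 (g i)^-1%g) /\
    forall i (x : @unitI R), \val x < 1 ->
      phi (\val (g i x)) = pl (path_node u i) (phi (\val x)).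
Proof.
move=> ephi ured; have [_ _ phiP] := ephi.
have incr := path_node_incr ured.
have /choice[g gP] (i : 'I_r) : exists g : homeoI R, forall x : @unitI R,
    \val x < 1 -> phi (\val (g x)) = pl (path_node u i) (phi (\val x)).
  by apply: (chart_conj ephi (path_node0 u i) _ (incr i)); rewrite invr_gt0.
exists g; split=> // i.
(* The lower constant 1/3 is what makes the inverse 3-Lipschitz. *)
have bilip (x y : @unitI R) : \val x < 1 -> \val y < 1 ->
    3^-1 * `|phi (\val x) - phi (\val y)| <=
      `|phi (\val (g i x)) - phi (\val (g i y))| <=
    3 * `|phi (\val x) - phi (\val y)|.
  move=> x1 y1; rewrite !gP //.
  have phi0 (z : @unitI R) : \val z < 1 -> phi (\val z) \in Num.nneg.
    move=> z1; have [|//] := phiP (\val z); rewrite z1 andbT.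
    by have := unitI_itv z; rewrite in_itv => /andP[].
  wlog xy : x y x1 y1 / phi (\val x) <= phi (\val y) => [wl|].
    have [|/ltW] := leP (phi (\val x)) (phi (\val y)); first exact: wl.
    by rewrite distrC [X in _ <= X <= _]distrC; exact: wl.
  have := pl_bilipschitz (incr i) (phi0 _ x1) (phi0 _ y1) xy.
  have sxy : 0 <= phi (\val y) - phi (\val x) by rewrite subr_ge0.
  move=> /[dup] /andP[lo _].
  rewrite distrC (ger0_norm sxy) distrC ger0_norm //.
  by apply: le_trans lo; rewrite mulr_ge0 ?invr_ge0.
split=> x y x1 y1; first by have /andP[] := bilip _ _ x1 y1.
have /andP[+ _] :=
  bilip _ _ (homeoI_lt1 (g i)^-1%g x1) (homeoI_lt1 (g i)^-1%g y1).
by rewrite !homeoI_invKV mulrC ler_pdivrMr // mulrC.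
Qed.

(** * The contradiction *)

Lemma content_not_mixed_identity r (w : freeProd (homeoI R) (freeGroup r)) :
  word_content w <> 1%g -> ~ is_mixed_identity w.
Proof.
move=> w1 [_ wid]; have [u wu ured] := reduced_repr (word_content w).
have u0 : (0 < size u)%N by case: u wu {ured} => // wu; case: w1.
have [C [cs [C0 close]]] := word_eval_content w (ler0n R 3).
(* With this [eps] the error C/(C+1) is below 1, hence below the displacement [size u]. *)
have C10 : 0 < (C + 1)^-1 by rewrite invr_gt0 ltr_wpDl.
have [e [phi [ephi fine]]] := fine_chart cs C10.
have [g [glip gpl]] := chart_path_lipschitz ephi ured.
have [_ eP phiP] := ephi.
have PU k : e k%:R \in @unitI R.
  have [/andP[e0 e1] _] := eP _ (ler0n R k).
  by rewrite inE /unitI /= in_itv /= e0 ltW.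
pose P k : @unitI R := exist _ (e k%:R) (PU k).
have P1 k : \val (P k) < 1 by have [/andP[]] := eP _ (ler0n R k).
have phiE k : phi (\val (P k)) = k%:R by have [] := eP _ (ler0n R k).
have gP i k l : path_node u i k = l%:R :> R -> g i (P k) = P l.
  move=> akl; apply: val_inj.
  have := gpl i (P k) (P1 k); rewrite phiE pl_nat akl => pg.
  have [|_ <-] := phiP (\val (g i (P k))); last by rewrite pg.
  rewrite homeoI_lt1 // andbT.
  by have := unitI_itv (g i (P k)); rewrite in_itv => /andP[].
have := close phi _ g (ltW C10) glip fine _ (P1 (size u).+1).
rewrite wid wu.
rewrite (_ : free_lift g (\pi_(freeGroup r)%qT u) = word_val g u); last first.
  exact: pres_lift_pi.
rewrite (word_val_path ured gP) !phiE.
apply/negP; rewrite -ltNge -natr1 addrK ger0_norm // ltr_pdivrMr ?ltr_wpDl //.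
have : 1 <= (size u)%:R :> R by rewrite ler1n.
by nra.
Qed.

End Words.

Theorem theorem5p1p2 (R : realType) (w : freeProd (homeoI R) (freeGroup 2)) :
  let derF2 : set (freeGroup 2) := commutator_subgroup setT setT in
  ~ commutator_subgroup derF2 derF2 (word_content w) ->
  ~ is_mixed_identity w.
Proof.
move=> derF2 w_notin; apply: content_not_mixed_identity => w1; apply: w_notin.
(* A trivial content would lie in every subgroup, in particular in the second derived subgroup. *)
by rewrite w1 => H [[H1 _] _]; rewrite inE in H1.
Qed.
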